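(* Consider the unit circle $\mathfrak{X}\subset\mathbb{R}^2$ equipped with geodesic metric $d$, normalised so that the diameter of $\mathfrak{X}$ is $1$. Let $\mu$ be a probability measure on $\mathfrak{X}$ which is absolutely continuous with respect to the uniform probability measure, with density $f$ satisfying $c\leq f(x)\leq C$ for every $x\in\mathfrak{X}$, where $0<c\leq C<\infty$. Given $\alpha\in(0,\infty)$ and $n\in\mathbb{N}$, define $$r(n)\equiv r(n,c,\alpha):=2c^{-1}\sqrt{(2+\alpha)\frac{\ln n}{n}}.$$ Then there exists $n_0\equiv n_0(c,C,\alpha)$, depending only on $c$, $C$, $\alpha$, such that $n\geq n_0$ implies that $(\mathfrak{X},d,\mu)$ is $(n,n^{-\alpha},r(n))$-disintegrable.
   Context: $\mathbb{N}=\{1,2,\dots\}$ and $[n]=\{1,\dots,n\}$. A metric Polish probability space $(\mathfrak{X},d,\mu)$ consists of a Polish space $\mathfrak{X}$, a (not necessarily complete) metric $d$ generating its topology, and a Borel probability measure $\mu$. $B(x,r)=\{y\in\mathfrak{X}: d(x,y)\leq r\}$ is the closed ball. Given $n\in\mathbb{N}$, $\epsilon>0$, $r>0$, $(\mathfrak{X},d,\mu)$ is $(n,\epsilon,r)$-disintegrable if, whenever $X_1,\dots,X_n$ are i.i.d. with distribution $\mu$ on a probability space $(\Psi,\mathcal{F},\mathbb{P})$, with $\mathbb{P}$-probability at least $1-\epsilon$ (i.e. on some event of probability at least $1-\epsilon$) there exists a disintegration of $\mu$ along the random multifunction $x\mapsto\{i\in[n]: x\in B(X_i,r)\}$ with respect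 to the uniform measure on $[n]$; that is, there exist Borel probability measures $\mu_1,\dots,\mu_n$ on $\mathfrak{X}$ with $\mu_i(B(X_i,r))=1$ for all $i$ and $\mu=\frac1n\sum_{i=1}^n\mu_i$. *)

(* Defs.v *)
From HB Require Import structures.
From mathcomp Require Import all_boot all_order all_algebra.
From mathcomp Require Import all_classical all_reals all_analysis.
From mathcomp Require Import ring lra.
Import Order.TTheory GRing.Theory Num.Theory.
Import numFieldNormedType.Exports.

Set Implicit Arguments.
Unset Strict Implicit.
Unset Printing Implicit Defensive.

Local Open Scope classical_set_scope.
Local Open Scope ring_scope.

#[short(type="pmetricType")]
HB.structure Definition PointedMetric (R : numDomainType) :=
  { T of Metric R T & isPointed T }.

Notation borel T := (g_sigma_algebraType (@open T)).

Definition cball (R : realType) (T : metricType R) (x : T) (r : R) : set T :=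
  [set y | mdist x y <= r].

Section iid.
Context d (Psi : measurableType d) (R : realType) (P : probability Psi R).
Context d' (T : measurableType d').
Local Open Scope ereal_scope.

Definition mutually_independent n (X : 'I_n -> {RV P >-> T}) : Prop :=
  forall (J : {set 'I_n}) (A : 'I_n -> set T),
    (forall i, i \in J -> measurable (A i)) ->
    P (\bigcap_(i in [set` J]) (X i @^-1` A i)) =
      \prod_(i in J) P (X i @^-1` A i).

Definition iid n (X : 'I_n -> {RV P >-> T}) (mu : probability T R) : Prop :=
  mutually_independent X /\
  forall i A, measurable A -> distribution P (X i) A = mu A.

End iid.

Section disintegrable.
Context (R : realType) (T : pmetricType R) (mu : probability (borel T) R).

(* Disintegration of mu along y |-> {i | y \in B(x i, r)} with respect to the
   uniform measure on the n indices. *)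
Definition disintegration n (r : R) (x : 'I_n -> T)
    (nu : 'I_n -> probability (borel T) R) : Prop :=
  (forall i, nu i (cball (x i) r) = 1%E) /\
  (forall A, measurable A ->
     mu A = ((n%:R^-1)%:E * \sum_(i < n) nu i A)%E).

(* The set of good outcomes need not be measurable: it is only required to
   contain an event E of probability at least 1 - eps. *)
Definition disintegrable (n : nat) (eps r : R) : Prop :=
  forall d (Psi : measurableType d) (P : probability Psi R)
    (X : 'I_n -> {RV P >-> borel T}),
  iid X mu ->
  exists E : set Psi,
    [/\ measurable E, ((1 - eps)%:E <= P E)%E &
        forall w, E w ->
          exists nu : 'I_n -> probability (borel T) R,
            disintegration r (fun i => X i w) nu].

End disintegrable.

Definition has_density d (T : measurableType d) (R : realType)
    (mu nu : probability T R) (f : T -> R) : Prop :=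
  measurable_fun setT f /\
  forall A, measurable A -> mu A = (\int[nu]_(x in A) (f x)%:E)%E.

Record circle (R : realType) := Circle {
  circle_val :> R * R;
  circle_eq1 : circle_val.1 ^+ 2 + circle_val.2 ^+ 2 == 1 }.

HB.instance Definition _ (R : realType) := [isSub for @circle_val R].
HB.instance Definition _ (R : realType) := [Choice of circle R by <:].

Section circle.
Context {R : realType}.
Implicit Types x y z : circle R.

Definition dotp x y : R :=
  (x : R * R).1 * (y : R * R).1 + (x : R * R).2 * (y : R * R).2.

(* Length of the shortest arc from x to y, i.e. the angle between x and y,
   divided by pi so that antipodal points are at distance 1. *)
Definition geodist x y : R := acos (dotp x y) / pi.

Lemma circleE x : (x : R * R).1 ^+ 2 + (x : R * R).2 ^+ 2 = 1.
Proof. exact/eqP/circle_eq1. Qed.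

Lemma dotp_itv x y : -1 <= dotp x y <= 1.
Proof.
have := circleE x; have := circleE y; rewrite /dotp.
case: (x : R * R) (y : R * R) => [a b] [c e] /= ce ab.
have h1 := sqr_ge0 (a - c); have h2 := sqr_ge0 (b - e).
have h3 := sqr_ge0 (a + c); have h4 := sqr_ge0 (b + e).
by apply/andP; split; nra.
Qed.

Lemma dotpxx x : dotp x x = 1.
Proof. by rewrite /dotp -!expr2 circleE. Qed.

Let geodistxx x : geodist x x = 0.
Proof. by rewrite /geodist dotpxx acos1 mul0r. Qed.

Let geodist_sym x y : geodist x y = geodist y x.
Proof. by rewrite /geodist /dotp; congr (acos _ / _); ring. Qed.

Let geodist_positivity x y : geodist x y = 0 -> x = y.
Proof.
move/eqP; rewrite /geodist mulf_eq0 invr_eq0 (gt_eqF (pi_gt0 R)) orbF => /eqP h.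
have : cos (acos (dotp x y)) = 1 by rewrite h cos0.
rewrite acosK ?in_itv//=; last exact: dotp_itv.
have abE := circleE x; have ceE := circleE y; rewrite /dotp => {}h.
apply/val_inj => /=; case: (x : R * R) (y : R * R) abE ceE h => [a b] [c e] /= abE ceE h.
have s : (a - c) ^+ 2 + (b - e) ^+ 2 = 0 by nra.
move/eqP: s; rewrite paddr_eq0 ?sqr_ge0// !sqrf_eq0 !subr_eq0.
by move=> /andP[/eqP -> /eqP ->].
Qed.

Let geodist_triangle y x z : geodist x z <= geodist x y + geodist y z.
Proof.
rewrite /geodist -mulrDl ler_pM2r ?invr_gt0 ?pi_gt0//.
have xy := dotp_itv x y; have yz := dotp_itv y z; have xz := dotp_itv x z.
have [pi_le|lt_pi] := leP pi (acos (dotp x y) + acos (dotp y z)).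
  by rewrite (le_trans _ pi_le)// acos_lepi.
rewrite leNgt -ltr_cos; last 2 first.
- by rewrite in_itv/= addr_ge0 ?acos_ge0// ltW.
- by rewrite in_itv/= acos_ge0// acos_lepi.
rewrite -leNgt cosD !acosK ?in_itv// !sin_acos//.
rewrite lerBlDr -lerBlDl.
have := circleE x; have := circleE y; have := circleE z; rewrite /dotp.
case: (x : R * R) (y : R * R) (z : R * R) => [a b] [c e] [u v] /= uv ce ab.
have -> : 1 - (a * c + b * e) ^+ 2 = (a * e - b * c) ^+ 2.
  by rewrite -[in LHS](mulr1 1) -{1}ab -ce; ring.
have -> : 1 - (c * u + e * v) ^+ 2 = (c * v - e * u) ^+ 2.
  by rewrite -[in LHS](mulr1 1) -{1}ce -uv; ring.
rewrite !sqrtr_sqr -normrM; apply: le_trans (ler_norm _).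
rewrite -[in X in _ - X <= _](mulr1 (a * u + b * v)) -ce.
by rewrite le_eqVlt; apply/orP; left; apply/eqP; ring.
Qed.

HB.instance Definition _ := @isMetric.Build R (circle R) geodist
  geodistxx geodist_positivity geodist_sym geodist_triangle.

Lemma cis_eq1 (t : R) : (cos t, sin t).1 ^+ 2 + (cos t, sin t).2 ^+ 2 == 1.
Proof. by rewrite /= cos2Dsin2. Qed.

Definition cis (t : R) : circle R := Circle (cis_eq1 t).

HB.instance Definition _ := isPointed.Build (circle R) (cis 0).

Lemma mdist_cis (s t : R) :
  `|s - t| <= pi -> mdist (cis s) (cis t) = `|s - t| / pi.
Proof.
move=> st; rewrite /mdist/= /geodist /dotp/= -cosB.
have -> : cos (s - t) = cos `|s - t|.
  by case: (ger0P (s - t)) => // _; rewrite cosN.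
by rewrite cosK// in_itv/= normr_ge0.
Qed.

Lemma continuous_cis : continuous cis.
Proof.
move=> s; apply/metricType_numDomainType.cvgrPdist_lt => e e0.
near=> t.
have stpi : `|s - t| < pi.
  near: t; apply/nbhs_ballP; exists pi => //=; exact: pi_gt0.
rewrite mdist_cis ?ltW// ltr_pdivrMr ?pi_gt0//.
near: t; apply/nbhs_ballP; exists (e * pi) => //=.
by rewrite mulr_gt0 ?pi_gt0.
Unshelve. all: by end_near. Qed.

Lemma measurable_cis :
  measurable_fun setT (cis : measurableTypeR R -> borel (circle R)).
Proof.
apply: (@measurability _ _ (measurableTypeR R) (borel (circle R)) setT cis
  (@open (circle R))) => // _ [U oU <-].
rewrite setTI; apply: measurable_realfun.open_measurable.
by move/continuousP : continuous_cis; apply.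
Qed.

HB.instance Definition _ :=
  isMeasurableFun.Build _ _ _ _ (cis : measurableTypeR R -> borel (circle R))
    measurable_cis.

Lemma cis_surj x : exists2 t, 0 <= t <= 2 * pi & cis t = x.
Proof.
case: x => [[a b] /= abE]; have /eqP/= ab := abE.
have a1 : -1 <= a <= 1.
  by have := sqr_ge0 b; have := sqr_ge0 (a - 1); have := sqr_ge0 (a + 1);
    move=> *; apply/andP; split; nra.
have sE : sin (acos a) = `|b|.
  by rewrite sin_acos// -sqrtr_sqr -ab; congr Num.sqrt; ring.
have ge0 := acos_ge0 a1; have lepi := acos_lepi a1; have p0 := pi_gt0 R.
have [b0|b0] := leP 0 b.
  exists (acos a); first by apply/andP; split; lra.
  by apply/val_inj; rewrite /= sE ger0_norm// acosK.
exists (2 * pi - acos a); first by apply/andP; split; lra.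
apply/val_inj => /=; have -> : 2 * pi - acos a = - acos a + pi *+ 2 by ring.
by rewrite cosD2pi sinD2pi cosN sinN acosK// sE ltr0_norm// opprK.
Qed.

Lemma circle_compact : compact [set: circle R].
Proof.
have -> : [set: circle R] = cis @` `[0, 2 * pi].
  apply/seteqP; split=> // x _; have [t tI <-] := cis_surj x.
  by exists t => //=; rewrite in_itv.
apply: continuous_compact; last exact: segment_compact.
exact/continuous_subspaceT/continuous_cis.
Qed.

Lemma twopi_gt0 : 0 < 2 * pi :> R.
Proof. by rewrite mulr_gt0 ?pi_gt0. Qed.

(* Law of (cos t, sin t) for t uniform on [0, 2 pi]. *)
Definition circle_uniform : probability (borel (circle R)) R :=
  distribution (uniform_prob twopi_gt0)
    (cis : {mfun measurableTypeR R >-> borel (circle R)}).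

End circle.

(* Main.v *)
Require Import Defs.
From HB Require Import structures.
From mathcomp Require Import all_boot all_order all_algebra.
From mathcomp Require Import all_classical all_reals all_analysis.
From mathcomp Require Import measurable_realfun ring lra zify.
Import Order.TTheory GRing.Theory Num.Theory.
Import numFieldNormedType.Exports.

Set Implicit Arguments.
Unset Strict Implicit.
Unset Printing Implicit Defensive.

Local Open Scope classical_set_scope.
Local Open Scope ring_scope.

(** Cut the circle at one point and let F(t) be the mu-mass of the arc of
    angles [0, t). Since the density lies between c and C, F is Lipschitz and
    satisfies c * (t - s) / (2 pi) <= F t - F s, so there are angles
    0 = q 0 <= q 1 <= ... <= q n = 2 pi with F (q k) = k / n; the arcs
    Q k = [q k, q k.+1) each have mass 1/n and partition the circle.

    Matching the sample with these arcs in the order of the angles gives the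
    disintegration: the point X_i of rank k receives nu_i, the measure mu
    conditioned on Q k (disintegration_of_counts). Averaging the nu_i over i
    recovers mu, because ranking is a bijection. The support condition holds as
    soon as the number N k of sample points of angle below q k satisfies
    |N k - k| <= n * delta - 1 for all k: if X_i lies in Q j, then its rank k is
    squeezed between N j and N (j + 1), hence |k - j| <= n * delta - 1. So the
    F-values of X_i and of any point of Q k differ by at most delta, and the
    lower bound on the density turns this into a distance of at most
    2 * delta / c (bucket_sub_cball). For
    delta = sqrt ((2 + alpha) * ln n / n) this is exactly r(n).

    It remains to bound the probability that some N k deviates. Each N k is
    binomial, and Chernoff's bound with parameter 2 * delta gives at most
    2 * exp (- n * delta^2 + 2 * delta) for each k (hits_deviation). Here
    exp (- n * delta^2) = n^(-2-alpha), so a union bound over the n + 1 values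
    of k leaves at most n^(-alpha) for n large (rate_bounds). The two spare
    powers of n are what makes this crude union bound sufficient. *)

(** * Binomial deviations of the number of hits *)

(** Squaring the reciprocal of exp (- x / 2) >= 1 - x / 2 gives
    exp x <= (1 - x / 2)^-2, which is below 1 + x + x^2 as long as
    1 - 3 x + x^2 >= 0; this is where the range of x comes from. *)
Lemma expR_le_quadratic (R : realType) (x : R) :
  x <= 3^-1 -> expR x <= 1 + x + x ^+ 2.
Proof.
move=> x3.
have pos : 0 < 1 - x / 2 by lra.
have h : 1 - x / 2 <= expR (- (x / 2)) by exact: expR_ge1Dx.
have : expR x * (1 - x / 2) ^+ 2 <= 1.
  rewrite -[leRHS](expRxMexpNx_1 x) ler_pM2l ?expR_gt0//.
  rewrite (_ : - x = - (x / 2) + - (x / 2)); last by field.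
  rewrite expRD -expr2 lerXn2r// nnegrE ?expR_ge0//; exact: ltW.
have : 1 <= (1 + x + x ^+ 2) * (1 - x / 2) ^+ 2.
  rewrite -subr_ge0.
  have -> : (1 + x + x ^+ 2) * (1 - x / 2) ^+ 2 - 1 =
    x ^+ 2 * ((1 - 3 * x + x ^+ 2) / 4) by field.
  by rewrite mulr_ge0 ?sqr_ge0// divr_ge0// addr_ge0 ?sqr_ge0//; lra.
move=> h1 h2; rewrite -(@ler_pM2r _ ((1 - x / 2) ^+ 2)) ?exprn_gt0//.
exact: le_trans h1.
Qed.

(** After centring, the linear terms of the quadratic bound on the exponential
    cancel and what remains is s^2 times the variance p (1 - p) <= 1/4. The
    constant 1/4, twice the one of Hoeffding's lemma, is good enough for
    the rate needed below. *)
Lemma bernoulli_mgf_le (R : realType) (p s : R) :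
  0 <= p <= 1 -> 0 <= s <= 3^-1 ->
  p * expR s + (1 - p) <= expR (s * p + s ^+ 2 / 4).
Proof.
move=> /andP[p0 p1] /andP[s0 s3].
have e1 := @expR_le_quadratic _ (s * (1 - p)) ltac:(nra).
have e2 := @expR_le_quadratic _ (- (s * p)) ltac:(nra).
have -> : p * expR s + (1 - p) =
    expR (s * p) * (p * expR (s * (1 - p)) + (1 - p) * expR (- (s * p))).
  rewrite mulrDr mulrCA -expRD [X in _ = _ + X]mulrCA expRxMexpNx_1 mulr1.
  by congr (p * expR _ + _); ring.
rewrite expRD ler_pM2l ?expR_gt0//.
apply: le_trans (expR_ge1Dx _).
have pp : p * (1 - p) <= 4^-1 by have := sqr_ge0 (p - 2^-1); nra.
have := ler_wpM2l p0 e1; have := ler_wpM2l (_ : 0 <= 1 - p) e2.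
have := ler_wpM2l (sqr_ge0 s) pp.
by move=> ? /(_ ltac:(lra)); nra.
Qed.

Lemma measure_bigsetU_le (R : realType) (d : measure_display)
    (T : measurableType d) (mu : {measure set T -> \bar R})
    (I : finType) (Q : pred I) (A : I -> set T) :
  (forall i, measurable (A i)) ->
  measurable (\big[setU/set0]_(i | Q i) A i) /\
  (mu (\big[setU/set0]_(i | Q i) A i) <= \sum_(i | Q i) mu (A i))%E.
Proof.
move=> mA; elim/big_rec2: _ => [|i y B _ [mB yB]]; first by rewrite measure0.
split; first exact: measurableU.
by apply: le_trans (measureU2 _ _ _) _ => //; rewrite leeD2l.
Qed.

(** The pattern of indices whose sample falls in A, kept as a finite set so
    that its law is a finite product and no expectation has to be integrated. *)
Definition hits (Psi T : Type) n (X : 'I_n -> Psi -> T) (A : set T) (w : Psi)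
  : {set 'I_n} := [set i | X i w \in A]%SET.

Lemma in_hits (Psi T : Type) n (X : 'I_n -> Psi -> T) (A : set T) (w : Psi) i :
  (i \in hits X A w) = (X i w \in A).
Proof. by rewrite inE. Qed.

Section tail.
Context (R : realType) (d : measure_display) (Psi : measurableType d)
  (P : probability Psi R) (d' : measure_display) (T : measurableType d')
  (n : nat) (X : 'I_n -> {RV P >-> T}) (mu : probability T R).
Hypothesis iidX : iid X mu.

Let Xf (i : 'I_n) : Psi -> T := X i.

Lemma hits_eqE (A : set T) (J : {set 'I_n}) :
  [set w | hits Xf A w = J] =
  \bigcap_(i in [set: 'I_n]) (X i @^-1` (if i \in J then A else ~` A)).
Proof.
apply/seteqP; split => w /=.
    by move=> <- i _; rewrite /preimage/= in_hits; case: ifPn => [/set_mem//|/negP];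
      rewrite inE.
  move=> h; apply/setP => i; rewrite in_hits; have := h i I; rewrite /preimage/=.
  by case: ifPn => iJ; [move/mem_set|move=> /= nA; apply/negbTE/negP; rewrite inE].
Qed.

Lemma measurable_hits_eq (A : set T) (J : {set 'I_n}) :
  measurable A -> measurable [set w | hits Xf A w = J].
Proof.
move=> mA.
rewrite hits_eqE; apply: fin_bigcap_measurable => // i _.
rewrite -[X in measurable X]setTI; apply: measurable_funPT => //.
by case: ifPn => // _; exact: measurableC.
Qed.

Lemma hits_eq_prob (A : set T) (J : {set 'I_n}) : measurable A ->
  P [set w | hits Xf A w = J] =
  (\prod_(i < n) (if i \in J then fine (mu A) else 1 - fine (mu A)))%:E.
Proof.
move=> mA.
rewrite hits_eqE (_ : [set: 'I_n] = [set` [set: 'I_n]%SET]); last first.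
  by apply/seteqP; split => // i _; rewrite /= finset.in_setT.
case: iidX => ind dis; rewrite ind; last first.
  by move=> i _; case: ifPn => // _; exact: measurableC.
rewrite -prodEFin; apply: eq_big => [i|i _]; first by rewrite inE.
have fA : mu A = (fine (mu A))%:E by rewrite fineK// fin_num_measure.
case: ifPn => iJ; first by rewrite -fA -(dis i A).
transitivity (distribution P (X i) (~` A)); first by [].
rewrite dis; last exact: measurableC.
by rewrite probability_setC// {1}fA.
Qed.

(** Chernoff's bound: the event is the finite union of the patterns J of large
    cardinal, the probability of J is weighted by exp (s (#|J| - a)) >= 1, and
    distributivity sums the weighted probabilities of all patterns to
    exp (- s a) (p exp s + 1 - p)^n. The choice s = 2 delta minimises the
    leading part n s^2 / 4 - s n delta of the exponent; the deviation being
    n delta - 1 and not n delta costs the extra term 2 delta. *)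
Lemma hits_upper_tail (A : set T) (delta : R) (p := fine (mu A)) :
  measurable A -> 0 <= delta <= 6^-1 ->
  let bad := [set w | n%:R * p + (n%:R * delta - 1) < #|hits Xf A w|%:R] in
  measurable bad /\
  (P bad <= (expR (- (n%:R * delta ^+ 2) + 2 * delta))%:E)%E.
Proof.
move=> mA /andP[d0 d6] bad.
pose a := n%:R * p + (n%:R * delta - 1).
pose s := 2 * delta.
have p01 : 0 <= p <= 1.
  rewrite fine_ge0//= -lee_fin fineK ?probability_le1//.
  exact: fin_num_measure.
have badE : bad =
    \big[setU/set0]_(J : {set 'I_n} | a < #|J|%:R) [set w | hits Xf A w = J].
  apply/seteqP; split=> w; rewrite -(bigcup_pred (fun J : {set 'I_n} => a < #|J|%:R)).
    by move=> bw; exists (hits Xf A w).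
  by move=> [J aJ /= hJ]; rewrite /bad /= hJ.
have [mB le] := @measure_bigsetU_le _ _ _ P _
  (fun J : {set 'I_n} => a < #|J|%:R) _ (fun J => measurable_hits_eq J mA).
rewrite -badE in mB le.
split=> //; apply: (le_trans le).
rewrite (eq_bigr _ (fun J _ => hits_eq_prob J mA)) sumEFin lee_fin.
pose w (J : {set 'I_n}) := \prod_(i < n) (if i \in J then p else 1 - p).
apply: (@le_trans _ _ (\sum_(J : {set 'I_n})
   expR (- (s * a)) * \prod_(i < n) (if i \in J then p * expR s else 1 - p))).
  rewrite [leLHS]big_mkcond/=; apply: ler_sum => J _.
  have -> : \prod_(i < n) (if i \in J then p * expR s else 1 - p) =
      expR (s * #|J|%:R) * w J.
    transitivity (\prod_(i < n) ((if i \in J then expR s else 1) *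
        (if i \in J then p else 1 - p))).
      by apply: eq_bigr => i _; case: ifPn => _; rewrite ?mul1r// mulrC.
    rewrite big_split/=; congr (_ * _).
    by rewrite -big_mkcond/= prodr_const -expRM_natl mulrC.
  have w0 : 0 <= w J.
    by apply: prodr_ge0 => i _; case: ifPn => _; move: p01; lra.
  rewrite mulrA -expRD; case: ifPn => [aJ|_]; last first.
    by rewrite mulr_ge0// expR_ge0.
  rewrite -/p -/(w J) ler_peMl// -[X in X <= _]expR0 ler_expR addrC -mulrBr mulr_ge0//.
    by rewrite /s; lra.
  by rewrite subr_ge0 ltW.
rewrite -mulr_sumr.
rewrite -(bigA_distr _ _ (fun=> p * expR s) (fun=> 1 - p))/=.
rewrite prodr_const card_ord.
have mgf := @bernoulli_mgf_le _ p s p01 ltac:(rewrite /s; lra).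
apply: (@le_trans _ _ (expR (- (s * a)) * expR (s * p + s ^+ 2 / 4) ^+ n)).
  rewrite ler_pM2l ?expR_gt0//; apply: lerXn2r => //.
    by rewrite nnegrE addr_ge0 ?mulr_ge0 ?expR_ge0//; move: p01; lra.
  by rewrite nnegrE expR_ge0.
rewrite -expRM_natl -expRD ler_expR /a /s -mulr_natl.
by rewrite le_eqVlt; apply/orP; left; apply/eqP; field.
Qed.

(** A lower deviation of the number of hits of A is an upper deviation of the
    number of hits of its complement. *)
Lemma hits_deviation (A : set T) (delta : R) (p := fine (mu A)) :
  measurable A -> 0 <= delta <= 6^-1 ->
  let bad := [set w | n%:R * delta - 1 < `|#|hits Xf A w|%:R - n%:R * p| ] in
  measurable bad /\
  (P bad <= (2 * expR (- (n%:R * delta ^+ 2) + 2 * delta))%:E)%E.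
Proof.
move=> mA d06 bad.
have [mU leU] := hits_upper_tail mA d06.
have [mL leL] := hits_upper_tail (measurableC mA) d06.
set U := [set w | _] in mU leU; set L := [set w | _] in mL leL.
have hC w : #|hits Xf (~` A) w|%:R = n%:R - #|hits Xf A w|%:R :> R.
  have -> : hits Xf (~` A) w = (~: hits Xf A w)%SET.
    by apply/setP => i; rewrite finset.in_setC !in_hits in_setC.
  by rewrite cardsCs finset.setCK card_ord natrB// -[leqRHS](card_ord n) max_card.
have pC : fine (mu (~` A)) = 1 - p.
  by rewrite probability_setC// -[mu A]fineK// fin_num_measure.
have badE : bad = U `|` L.
  apply/seteqP; split => w; rewrite /bad /U /L/= pC hC -/p lter_normr.
    by case/orP => h; [left|right]; lra.
  by case=> h; apply/orP; [left|right]; lra.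
rewrite badE; split; first exact: measurableU.
apply: le_trans (measureU2 _ _ _) _ => //.
by rewrite mulr_natl mulr2n EFinD leeD.
Qed.

End tail.

Lemma hits_uniform_deviation (R : realType) (d : measure_display)
    (Psi : measurableType d) (P : probability Psi R) (d' : measure_display)
    (T : measurableType d') (n : nat) (X : 'I_n -> {RV P >-> T})
    (mu : probability T R) (I : finType) (A : I -> set T) (delta : R) :
  iid X mu -> (forall k, measurable (A k)) -> 0 <= delta <= 6^-1 ->
  exists E : set Psi, [/\ measurable E,
    ((1 - #|I|%:R * (2 * expR (- (n%:R * delta ^+ 2) + 2 * delta)))%:E <= P E)%E &
    forall w, E w -> forall k,
      `|#|hits (fun i => X i : Psi -> T) (A k) w|%:R - n%:R * fine (mu (A k))|
        <= n%:R * delta - 1].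
Proof.
move=> iidX mA d6.
pose bad k := [set w | n%:R * delta - 1 <
  `|#|hits (fun i => X i : Psi -> T) (A k) w|%:R - n%:R * fine (mu (A k))| ].
have dev k := hits_deviation iidX (mA k) d6.
have [mB le] := @measure_bigsetU_le _ _ _ P _ xpredT bad (fun k => (dev k).1).
exists (~` \big[setU/set0]_k bad k); split.
- exact: measurableC.
- rewrite probability_setC// EFinB leeB//; apply: (le_trans le).
  apply: (@le_trans _ _ (\sum_(k : I)
      (2 * expR (- (n%:R * delta ^+ 2) + 2 * delta))%:E)%E).
    by apply: lee_sum => k _; exact: (dev k).2.
  by rewrite sumEFin lee_fin sumr_const -[leLHS]mulr_natl.
- move=> w nw k; rewrite leNgt; apply/negP => bw; apply: nw.
  by rewrite (bigD1 k)//=; left.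
Qed.

(** * Angles and arcs on the circle *)

Lemma cis_inj (R : realType) (u v : R) :
  0 <= u < 2 * pi -> 0 <= v < 2 * pi -> cis u = cis v -> u = v.
Proof.
move=> uI vI uv.
have [cuv suv] : cos u = cos v /\ sin u = sin v.
  by have := congr1 (@circle_val R) uv => -[].
wlog vu : u v uI vI {uv} cuv suv / v <= u.
  move=> W; have [|/ltW] := leP v u; first exact: W.
  by move=> vu; apply/esym; apply: W.
apply/eqP; rewrite eq_le vu andbT leNgt; apply/negP => lt_vu.
have : 0 < sin ((u - v) / 2).
  by apply: sin_gt0_pi; apply/andP; split; lra.
have : cos ((u - v) / 2 + (u - v) / 2) = 1.
  have -> : (u - v) / 2 + (u - v) / 2 = u - v by field.
  by rewrite cosB cuv suv -!expr2 cos2Dsin2.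
rewrite cosD -!expr2 => h1 h2; have := cos2Dsin2 ((u - v) / 2).
by have := exprn_gt0 2 h2; lra.
Qed.

Lemma cis_surj_half_open (R : realType) (x : circle R) :
  exists t : R, 0 <= t < 2 * pi /\ cis t = x.
Proof.
have [t /andP[t0 t2] tx] := cis_surj x.
have [lt|ge] := ltP t (2 * pi); first by exists t; rewrite t0.
exists 0; rewrite lexx twopi_gt0; split=> //.
have tE : t = 0 + pi *+ 2 by lra.
by rewrite -tx; apply/val_inj; rewrite /= tE cosD2pi sinD2pi.
Qed.

(** The angle in [0, 2 pi), that is, the coordinate on the circle cut open at
    cis 0. *)
Definition arg (R : realType) (x : circle R) : R :=
  sval (cid (cis_surj_half_open x)).

Section arg.
Context {R : realType}.
Implicit Types (x y : circle R) (s t : R).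

Lemma arg_itv x : 0 <= arg x < 2 * pi.
Proof. by rewrite /arg; case: cid => t []. Qed.

Lemma argK x : cis (arg x) = x.
Proof. by rewrite /arg; case: cid => t []. Qed.

Lemma cisK t : 0 <= t < 2 * pi -> arg (cis t) = t.
Proof. by move=> tI; apply: cis_inj => //; [exact: arg_itv|exact: argK]. Qed.

(** Only an inequality: the difference of angles measures the arc which avoids
    the cut, and the shortest arc may cross it. *)
Lemma mdist_le_arg x y : mdist x y <= `|arg x - arg y| / pi.
Proof.
have [le|lt] := leP `|arg x - arg y| pi.
  by rewrite -{1}(argK x) -{1}(argK y) mdist_cis.
apply: (@le_trans _ _ 1); last by rewrite ler_pdivlMr ?pi_gt0// mul1r ltW.
by rewrite /mdist/= /geodist ler_pdivrMr ?pi_gt0// mul1r acos_lepi// dotp_itv.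
Qed.

Lemma closed_measurable_borel (T : pmetricType R) (A : set T) :
  closed A -> measurable (A : set (borel T)).
Proof.
move=> cA; rewrite -(setCK A); apply: measurableC.
by apply: sub_sigma_algebra; exact: closed_openC.
Qed.

(** The angle is not continuous at the cut, so its sublevel sets are neither
    open nor closed. For 0 < s < 2 pi the complement is the compact image of
    [s, 2 pi] deprived of the cut point, which cis reaches at 2 pi. *)
Lemma measurable_arg_lt s : measurable [set x : borel (circle R) | arg x < s].
Proof.
have [s0|s0] := leP s 0.
  rewrite (_ : [set _ | _] = set0)//; apply/seteqP; split=> // x /=.
  by have := arg_itv x; lra.
have [s2|s2] := leP (2 * pi) s.
  rewrite (_ : [set _ | _] = setT)//; apply/seteqP; split=> // x _ /=.
  by have := arg_itv x; lra.
have -> : [set x : borel (circle R) | arg x < s] =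
    ~` ((cis @` `[s, 2 * pi]) `\` [set cis 0]).
  apply/seteqP; split => x /=.
    move=> xs [[t]]; rewrite /= in_itv/= => /andP[st t2] tx x0.
    have [lt|ge] := ltP t (2 * pi).
      by move: xs; rewrite -tx cisK ?ltNge ?st//; apply/andP; split=> //; lra.
    apply: x0; have tE : t = 0 + pi *+ 2 by lra.
    by rewrite -tx; apply/val_inj; rewrite /= tE cosD2pi sinD2pi.
  move=> nx; rewrite ltNge; apply/negP => sx; apply: nx; split.
    exists (arg x); last exact: argK.
    by rewrite /= in_itv/= sx; have := arg_itv x; lra.
  move=> /= x0; move: sx; rewrite x0 cisK ?lexx ?twopi_gt0//; lra.
apply: measurableC; apply: measurableD; apply: closed_measurable_borel.
  apply: compact_closed; first exact: metric_hausdorff.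
  apply: continuous_compact; last exact: segment_compact.
  exact/continuous_subspaceT/continuous_cis.
apply: compact_closed; [exact: metric_hausdorff|exact: compact_set1].
Qed.

Definition circle_arc s t : set (borel (circle R)) := [set x | s <= arg x < t].

Lemma arcE s t :
  circle_arc s t = [set x | arg x < t] `\` [set x | arg x < s].
Proof.
apply/seteqP; split=> x; rewrite /circle_arc/=; first by move=> /andP[+ ->]; lra.
by move=> [-> /negP]; rewrite -leNgt => ->.
Qed.

Lemma measurable_arc s t : measurable (circle_arc s t).
Proof. by rewrite arcE; apply: measurableD; exact: measurable_arg_lt. Qed.

(** The preimage of the arc under cis contains [s, t), whose uniform mass is
    the left-hand side. The preimage may be larger, since cis is periodic;
    circle_uniform_arc recovers the equality. *)
Lemma circle_uniform_arc_ge s t : 0 <= s -> s <= t -> t <= 2 * pi ->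
  (((t - s) / (2 * pi))%:E <= circle_uniform (circle_arc s t))%E.
Proof.
move=> s0 st t2.
have sub : `[s, t[ `<=` (cis : _ -> _) @^-1` (circle_arc s t).
  move=> u /=; rewrite in_itv/= /circle_arc /preimage/= => /andP[su ut].
  by rewrite cisK ?su//; apply/andP; split; lra.
apply: (@le_trans _ _ (uniform_prob (@twopi_gt0 R) `[s, t[)); last first.
  apply: le_measure => //; rewrite ?inE//.
  rewrite -[X in measurable X]setTI; apply: measurable_cis => //.
  exact: measurable_arc.
rewrite /uniform_prob (eq_integral (fun=> (2 * pi)^-1%:E)); last first.
  move=> u; rewrite inE/= in_itv/= /uniform_pdf => /andP[su ut].
  by rewrite subr0 ifT//; apply/andP; split; lra.
rewrite integral_cst//= lebesgue_measure_itv/= lte_fin.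
case: ifPn => [_|]; first by rewrite -EFinB -EFinM mulrC.
by rewrite mule0 -leNgt => ts; rewrite lee_fin (_ : t - s = 0) ?mul0r//; lra.
Qed.

Lemma measure_setI_arc_cat (mu : probability (borel (circle R)) R)
    (A : set (borel (circle R))) s t u :
  measurable A -> s <= t -> t <= u ->
  fine (mu (A `&` circle_arc s u)) =
    fine (mu (A `&` circle_arc s t)) + fine (mu (A `&` circle_arc t u)).
Proof.
move=> mA st tu.
have mAarc v w : measurable (A `&` circle_arc v w).
  by apply: measurableI => //; exact: measurable_arc.
have -> : circle_arc s u = circle_arc s t `|` circle_arc t u.
  apply/seteqP; split => x; rewrite /circle_arc/=.
    by have [xt|tx] := ltP (arg x) t; [left|right]; lra.
  by case; lra.
rewrite setIUr measureU//; last first.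
  by apply/seteqP; split => // x; rewrite /circle_arc/=; lra.
by rewrite fineD// fin_num_measure.
Qed.

Lemma measure_arc_cat (mu : probability (borel (circle R)) R) s t u :
  s <= t -> t <= u ->
  fine (mu (circle_arc s u)) = fine (mu (circle_arc s t)) + fine (mu (circle_arc t u)).
Proof.
by move=> st tu; have := measure_setI_arc_cat mu measurableT st tu; rewrite !setTI.
Qed.

Lemma measure_arc_full (mu : probability (borel (circle R)) R) :
  fine (mu (circle_arc 0 (2 * pi))) = 1.
Proof.
rewrite (_ : circle_arc _ _ = setT) ?probability_setT//.
by apply/seteqP; split => // x _; exact: arg_itv.
Qed.

(** The three arcs cut out by s and t have total mass 1, and so have their lower
    bounds, so each lower bound is attained. *)
Lemma circle_uniform_arc s t : 0 <= s -> s <= t -> t <= 2 * pi ->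
  fine (circle_uniform (circle_arc s t)) = (t - s) / (2 * pi) :> R.
Proof.
move=> s0 st t2.
have ge a b : 0 <= a -> a <= b -> b <= 2 * pi ->
    (b - a) / (2 * pi) <= fine (circle_uniform (circle_arc a b)).
  move=> a0 ab b2; rewrite -lee_fin fineK ?circle_uniform_arc_ge//.
  by rewrite fin_num_measure//; exact: measurable_arc.
have := measure_arc_full circle_uniform.
rewrite (@measure_arc_cat _ 0 s)//; last lra.
rewrite (@measure_arc_cat _ s t)//.
have := ge 0 s (lexx _) s0 ltac:(lra); have := ge s t s0 st t2.
have := ge t (2 * pi) ltac:(lra) t2 (lexx _).
have tiles (p : R) : p != 0 -> (p - t) / p + (t - s) / p + (s - 0) / p = 1.
  by move=> p0; field.
have := tiles (2 * pi) (lt0r_neq0 twopi_gt0).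
lra.
Qed.

End arg.

(** * Quantiles of a measure with bounded density *)

Lemma density_bounds (R : realType) (d : measure_display)
    (T : measurableType d) (mu nu : probability T R)
    (f : T -> R) (c C : R) (A : set T) :
  has_density mu nu f -> 0 <= c -> (forall x, c <= f x <= C) -> measurable A ->
  c * fine (nu A) <= fine (mu A) <= C * fine (nu A).
Proof.
move=> [mf muE] c0 cfC mA.
have mfE : @measurable_fun _ _ T (\bar R) A (EFin \o f).
  by apply/measurable_EFinP; exact: measurable_funS mf.
have f0 x : 0 <= f x by case/andP: (cfC x) => h _; exact: le_trans h.
rewrite -!lee_fin !EFinM !fineK ?fin_num_measure//.
rewrite muE//; apply/andP; split.
  rewrite -integral_cst//; apply: ge0_le_integral => //.
    by move=> x _; rewrite lee_fin; case/andP: (cfC x).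
rewrite -integral_cst//; apply: ge0_le_integral => // x _.
  by rewrite lee_fin f0.
by rewrite lee_fin; case/andP: (cfC x).
Qed.

(** Existence of quantiles: upper bounds on the increments of a monotone F make
    it continuous. *)
Lemma lipschitz_ivt (R : realType) (F : R -> R) (a b K : R) :
  a <= b -> 0 <= K ->
  (forall s t, a <= s -> s <= t -> t <= b -> 0 <= F t - F s <= K * (t - s)) ->
  forall v, F a <= v <= F b -> exists2 s, a <= s <= b & F s = v.
Proof.
move=> ab K0 lipF v vI.
have lip s t : a <= s <= b -> a <= t <= b -> `|F s - F t| <= K * `|s - t|.
  move=> sI tI; wlog st : s t sI tI / s <= t.
    move=> W; have [|/ltW] := leP s t; first exact: W.
    by rewrite distrC [X in K * X]distrC; exact: W.
  have := lipF s t ltac:(lra) st ltac:(lra) => /andP[h1 h2].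
  by rewrite distrC ger0_norm// distrC ger0_norm ?subr_ge0.
have [] := @IVT _ F a b v ab.
- apply/subspace_continuousP => x /=; rewrite in_itv/= => xI.
  apply/cvgrPdist_le => e e0.
  have K1 : 0 < K + 1 by lra.
  rewrite near_withinE; near=> t => /=; rewrite in_itv/= => tI.
  apply: (le_trans (lip x t xI tI)).
  apply: (@le_trans _ _ ((K + 1) * `|x - t|)).
    by rewrite ler_wpM2r//; lra.
  rewrite mulrC -ler_pdivlMr//.
  near: t; apply/nbhs_ballP; exists (e / (K + 1)); first exact: divr_gt0.
  by move=> t /ltW.
- have Fab : F a <= F b by have := lipF a b (lexx _) ab (lexx _); lra.
  by rewrite min_l// max_r.
- by move=> s; rewrite in_itv/= => sI <-; exists s.
Unshelve. all: by end_near. Qed.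

(** * Matching the sample with the quantile arcs *)

(** The rank of i counts the indices that precede it in the lexicographic order
    on pairs (theta i, i). Breaking ties by the index makes the rank injective
    without assuming that the values are distinct. *)
Lemma rank_exists (R : realDomainType) n (theta : 'I_n -> R) :
  exists sigma : 'I_n -> 'I_n, injective sigma /\
    forall i, (#|[set j | (theta j < theta i)%R]%SET| <= sigma i <
               #|[set j | (theta j <= theta i)%R]%SET|)%N.
Proof.
pose before j i := (theta j < theta i) || ((theta j == theta i) && (j < i)%N).
pose B i := [set j | before j i]%SET.
have irr i : before i i = false by rewrite /before ltxx ltnn andbF.
have sub i : (B i \proper [set j | theta j <= theta i])%SET.
  apply/fintype.properP; split.
    apply/fintype.subsetP => j; rewrite !inE /before => /orP[/ltW//|/andP[/eqP->]].
    by rewrite lexx.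
  by exists i; rewrite !inE ?irr.
have ltBn i : (#|B i| < n)%N.
  by rewrite (leq_trans (proper_card (sub i)))// -[leqRHS]card_ord max_card.
exists (fun i => Ordinal (ltBn i)); split; last first.
  move=> i /=; rewrite proper_card ?sub// andbT.
  apply: subset_leq_card; apply/fintype.subsetP => j.
  by rewrite !inE /before => ->.
have beforeB j i : before j i -> (#|B j| < #|B i|)%N.
  move=> ji; apply: proper_card; apply/fintype.properP; split.
    apply/fintype.subsetP => k; rewrite !inE => kj; move: kj ji; rewrite /before.
    move=> /orP[kj|/andP[/eqP -> kj]] /orP[ji|/andP[/eqP jiE ji]].
    - by rewrite (lt_trans kj ji).
    - by rewrite -jiE kj.
    - by rewrite ji.
    - by rewrite jiE eqxx (ltn_trans kj ji) orbT.
  by exists j; rewrite !inE ?irr.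
move=> i j [cardE]; apply/eqP; apply: contraT => ij.
have : before i j || before j i.
  rewrite /before; case: (ltgtP (theta i) (theta j)) => //= _.
  by rewrite -neq_ltn.
by case/orP => /beforeB; rewrite cardE ltnn.
Qed.

(** In this section q k is a quantile of order k / n of mu, and the lower bound
    on the mass of arcs is the only consequence of the density bounds in use. *)
Section matching.
Context (R : realType) (mu : probability (borel (circle R)) R)
  (c : R) (n : nat) (q : nat -> R).
Hypotheses (c0 : 0 < c) (n0 : (0 < n)%N).
Hypothesis mu_ge : forall s t, 0 <= s -> s <= t -> t <= 2 * pi ->
  c * ((t - s) / (2 * pi)) <= fine (mu (circle_arc s t)).
Hypothesis qI : forall k, 0 <= q k <= 2 * pi.
Hypothesis qE : forall k, (k <= n)%N -> fine (mu (circle_arc 0 (q k))) = k%:R / n%:R.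

Lemma quantile_mono k l : (k <= l <= n)%N -> q k <= q l.
Proof.
move=> /andP[kl ln]; rewrite leNgt; apply/negP => lt.
have /andP[l0 _] := qI l; have /andP[_ k2] := qI k.
have := mu_ge l0 (ltW lt) k2.
have := measure_arc_cat mu l0 (ltW lt).
rewrite !qE//; last exact: leq_trans kl ln.
have : 0 < c * ((q k - q l) / (2 * pi)).
  by rewrite mulr_gt0// divr_gt0 ?twopi_gt0// subr_gt0.
have : k%:R / n%:R <= l%:R / n%:R :> R.
  by rewrite ler_pM2r ?ler_nat// invr_gt0 ltr0n.
lra.
Qed.

Lemma quantile0 : q 0 = 0.
Proof.
have /andP[l0 k2] := qI 0.
have := mu_ge (lexx _) l0 k2; rewrite qE// mul0r subr0 => h.
apply/eqP; rewrite eq_le l0 andbT.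
by move: h; rewrite pmulr_rle0// pmulr_lle0// invr_gt0 twopi_gt0.
Qed.

Lemma quantileS k : (k < n)%N -> fine (mu (circle_arc (q k) (q k.+1))) = n%:R^-1.
Proof.
move=> kn; have /andP[l0 _] := qI k.
have := @measure_arc_cat _ mu _ _ _ l0 (@quantile_mono k k.+1 ltac:(lia)).
rewrite !qE//; last exact: ltnW.
by rewrite -natr1 mulrDl mul1r; lra.
Qed.

Lemma quantilen : q n = 2 * pi.
Proof.
have /andP[l0 k2] := qI n.
have := mu_ge l0 k2 (lexx _).
have := measure_arc_cat mu l0 k2.
rewrite measure_arc_full qE// divff ?pnatr_eq0 -?lt0n// => h1 h2.
apply/eqP; rewrite eq_le k2/= -subr_le0.
have : c * ((2 * pi - q n) / (2 * pi)) <= 0 by lra.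
by rewrite pmulr_rle0// pmulr_lle0// invr_gt0 twopi_gt0.
Qed.

Lemma quantile_bucket (y : circle R) :
  exists2 k, (k < n)%N & q k <= arg y < q k.+1.
Proof.
suff H m : (m <= n)%N -> arg y < q m ->
    exists2 k, (k < m)%N & q k <= arg y < q k.+1.
  by apply: H => //; rewrite quantilen; have := arg_itv y; lra.
elim: m => [_|m IH mn ym]; first by rewrite quantile0; have := arg_itv y; lra.
have [my|/(IH (ltnW mn))[k km ky]] := leP (q m) (arg y).
  by exists m => //; rewrite my.
by exists k => //; exact: ltnW.
Qed.

Lemma sum_measure_buckets (A : set (borel (circle R))) : measurable A ->
  \sum_(k < n) fine (mu (A `&` circle_arc (q k) (q k.+1))) = fine (mu A).
Proof.
move=> mA.
have H m : (m <= n)%N -> \sum_(k < m) fine (mu (A `&` circle_arc (q k) (q k.+1))) =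
    fine (mu (A `&` circle_arc 0 (q m))).
  elim: m => [_|m IH mn].
    rewrite big_ord0 quantile0 (_ : circle_arc 0 0 = set0) ?setI0 ?measure0//.
    by apply/seteqP; split => // x; rewrite /circle_arc/=; lra.
  rewrite big_ord_recr/= IH; last exact: ltnW.
  rewrite -measure_setI_arc_cat//; first by case/andP: (qI m).
  by apply: quantile_mono; lia.
rewrite H// quantilen (_ : circle_arc 0 _ = setT) ?setIT//.
by apply/seteqP; split => // x _; exact: arg_itv.
Qed.

(** Between the angles of x and y there is mu-mass at most
    (|k - j| + 1) / n <= delta, as the arc between them is covered by at most
    |k - j| + 1 quantile arcs. The lower bound on the density bounds its length. *)
Lemma bucket_sub_cball (x y : circle R) (delta : R) (j k : nat) :
  (j < n)%N -> (k < n)%N ->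
  q j <= arg x < q j.+1 -> q k <= arg y < q k.+1 ->
  `|k%:R - j%:R| <= n%:R * delta - 1 ->
  mdist x y <= 2 * c^-1 * delta.
Proof.
move=> jn kn xj yk kj.
have np : 0 < n%:R :> R by rewrite ltr0n.
have nV : 0 < (n%:R^-1 : R) by rewrite invr_gt0.
have gap (a b : nat) (u v : circle R) : (a < n)%N -> (b < n)%N ->
    q a <= arg u < q a.+1 -> q b <= arg v < q b.+1 -> arg u <= arg v ->
    c * ((arg v - arg u) / (2 * pi)) <= (b%:R - a%:R + 1) / n%:R.
  move=> an bn /andP[au _] /andP[_ vb] uv.
  have /andP[u0 _] := arg_itv u; have /andP[a0 _] := qI a.
  have /andP[_ b2] := qI b.+1.
  apply: le_trans (mu_ge u0 uv _) _; first by lra.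
  have h1 := measure_arc_cat mu a0 (le_trans au (le_trans uv (ltW vb))).
  have h2 := measure_arc_cat mu au (le_trans uv (ltW vb)).
  have h3 := measure_arc_cat mu uv (ltW vb).
  have h4 : 0 <= fine (mu (circle_arc (q a) (arg u))) by rewrite fine_ge0.
  have h5 : 0 <= fine (mu (circle_arc (arg v) (q b.+1))) by rewrite fine_ge0.
  rewrite !qE// in h1; last exact: ltnW.
  have -> : (b%:R - a%:R + 1) / n%:R = b.+1%:R / n%:R - a%:R / n%:R :> R.
    by rewrite -natr1; ring.
  lra.
have key : c * (`|arg x - arg y| / (2 * pi)) <= delta.
  apply: (@le_trans _ _ ((`|k%:R - j%:R| + 1) / n%:R)); last first.
    by rewrite ler_pdivrMr//; lra.
  have [xy|/ltW yx] := leP (arg x) (arg y).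
    rewrite (distrC (arg x)) (ger0_norm (_ : 0 <= arg y - arg x)) ?subr_ge0//.
    apply: le_trans (gap _ _ _ _ jn kn xj yk xy) _.
    by rewrite ler_pM2r// lerD2r ler_norm.
  rewrite (ger0_norm (_ : 0 <= arg x - arg y)) ?subr_ge0//.
  apply: le_trans (gap _ _ _ _ kn jn yk xj yx) _.
  by rewrite ler_pM2r// lerD2r distrC ler_norm.
apply: le_trans (mdist_le_arg x y) _.
have p0 := pi_gt0 R.
have -> : `|arg x - arg y| / pi = 2 * c^-1 * (c * (`|arg x - arg y| / (2 * pi))).
  move: (pi : R) p0 => p p0; field.
  by rewrite !lt0r_neq0.
by rewrite ler_pM2l// mulr_gt0// invr_gt0.
Qed.

(** The point x i is given the mu-conditional law on the quantile arc whose
    index is the rank of x i. If x i lies in the arc of index j, all points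
    below q j have smaller rank and all points of smaller rank are below
    q (j + 1), so the rank is as close to j as the counts are to their
    expectations. *)
Lemma disintegration_of_counts (x : 'I_n -> circle R) (delta : R) :
  (forall k, (k <= n)%N ->
    `|#|[set i | x i \in circle_arc 0 (q k)]%SET|%:R - k%:R| <= n%:R * delta - 1) ->
  exists nu : 'I_n -> probability (borel (circle R)) R,
    disintegration mu (2 * c^-1 * delta) x nu.
Proof.
move=> counts.
have [sigma [sigma_inj sigmaE]] := rank_exists (fun i => arg (x i)).
pose Q k := circle_arc (q k) (q k.+1).
pose nu i : probability (borel (circle R)) R :=
  mnormalize (mrestr mu (measurable_arc (q (sigma i)) (q (sigma i).+1))) mu.
have np : 0 < n%:R :> R by rewrite ltr0n.
have muQ k : (k < n)%N -> mu (Q k) = (n%:R^-1)%:E.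
  move=> kn; rewrite -(quantileS kn) fineK// fin_num_measure//.
  exact: measurable_arc.
have nuE i A : nu i A = (mu (A `&` Q (sigma i)) * n%:R%:E)%E.
  (* mnormalize falls back on a default measure when the total mass is zero or
     infinite; here it is 1/n. *)
  rewrite /nu /= /mnormalize /= /mrestr setTI -/(Q _) muQ// ifF ?invrK//.
  by apply/negbTE; rewrite negb_or/= andbT eqe invr_eq0 gt_eqF.
exists nu; split=> [i|A mA].
  have sub : Q (sigma i) `<=` cball (x i) (2 * c^-1 * delta).
    move=> y yQ; have [j jn jx] := quantile_bucket (x i).
    apply: (bucket_sub_cball jn (ltn_ord (sigma i)) jx yQ).
    have /andP[lo hi] := sigmaE i.
    have cj := counts j (ltnW jn); have cj1 := counts j.+1 jn.
    have lo' : (#|[set i | x i \in circle_arc 0 (q j)]%SET| <= sigma i)%N.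
      apply: leq_trans lo; apply: subset_leq_card.
      apply/fintype.subsetP => l; rewrite !inE /circle_arc/= => /andP[_ h].
      by apply: lt_le_trans h _; case/andP: jx.
    have hi' : (sigma i < #|[set i | x i \in circle_arc 0 (q j.+1)]%SET|)%N.
      apply: leq_trans hi _; apply: subset_leq_card.
      apply/fintype.subsetP => l; rewrite !inE /circle_arc/= => h.
      have /andP[-> _] := arg_itv (x l).
      by apply: le_lt_trans h _; case/andP: jx.
    move: lo' hi'; rewrite -(ler_nat R) -(ltr_nat R) => lo' hi'.
    have hi2 : (sigma i)%:R + 1 <= #|[set i | x i \in circle_arc 0 (q j.+1)]%SET|%:R :> R.
      by rewrite natr1 ler_nat -(ltr_nat R).
    move: cj cj1; rewrite !ler_norml -natr1; lra.
  by rewrite nuE setIidr// muQ// -EFinM mulVf// gt_eqF.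
under eq_bigr do rewrite nuE.
have muI k : mu (A `&` Q k) = (fine (mu (A `&` Q k)))%:E.
  rewrite fineK// fin_num_measure//; apply: measurableI => //.
  exact: measurable_arc.
under eq_bigr do rewrite muI -EFinM.
rewrite sumEFin -EFinM -mulr_suml mulrCA mulVf ?gt_eqF// mulr1.
have <- : \sum_(k < n) fine (mu (A `&` Q k)) =
    \sum_(i < n) fine (mu (A `&` Q (sigma i))) by exact: reindex_inj.
by rewrite sum_measure_buckets// fineK// fin_num_measure.
Qed.

End matching.

(** * Choice of the radius *)

(** Apply ln y < y to y = sqrt x. *)
Lemma ln_over_id_le (R : realType) (x : R) : 0 < x ->
  ln x / x <= 2 / Num.sqrt x.
Proof.
move=> x0; have s0 : 0 < Num.sqrt x by rewrite sqrtr_gt0.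
have /ltW le := ln_sublinear s0.
have xE : Num.sqrt x ^+ 2 = x by rewrite sqr_sqrtr// ltW.
move: (Num.sqrt x) s0 le xE => s s0 le <-.
rewrite lnXn// ler_pdivrMr ?exprn_gt0//.
have -> : 2 / s * s ^+ 2 = 2 * s by field; exact: lt0r_neq0.
by rewrite mulr2n; lra.
Qed.

(** The threshold 72 (2 + alpha) <= sqrt n is what delta <= 1/6 requires through
    ln n / n <= 2 / sqrt n. Then exp (2 delta) <= 2, and the claim reduces to
    4 (n + 1) <= n^2, true from n = 5 on. *)
Lemma rate_bounds (R : realType) (alpha : R) : 0 < alpha ->
  exists n0 : nat, forall n : nat, (n0 <= n)%N -> (0 < n)%N ->
    let delta := Num.sqrt ((2 + alpha) * (ln n%:R / n%:R)) in
    0 <= delta <= 6^-1 /\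
    n.+1%:R * (2 * expR (- (n%:R * delta ^+ 2) + 2 * delta)) <=
      n%:R `^ (- alpha).
Proof.
move=> a0; pose K : R := (72 * (2 + alpha)) ^+ 2.
have K0 : 0 <= K by exact: sqr_ge0.
exists (maxn 5 (Num.bound K)) => n; rewrite geq_max => /andP[n5 nK] npos delta.
have n0 : 0 < n%:R :> R by rewrite ltr0n.
have n1 : 1 <= n%:R :> R by rewrite ler1n.
have rad0 : 0 <= (2 + alpha) * (ln n%:R / n%:R).
  by rewrite mulr_ge0 ?divr_ge0 ?ln_ge0//; lra.
have delta0 : 0 <= delta by exact: sqrtr_ge0.
have delta2 : delta ^+ 2 = (2 + alpha) * (ln n%:R / n%:R) by rewrite sqr_sqrtr.
have s0 : 0 < Num.sqrt n%:R :> R by rewrite sqrtr_gt0.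
have sK : 72 * (2 + alpha) <= Num.sqrt n%:R.
  rewrite -(@ger0_norm _ (72 * (2 + alpha))); last by lra.
  rewrite -sqrtr_sqr ler_sqrt ?ltW//.
  by apply: lt_le_trans (archi_boundP K0) _; rewrite ler_nat.
have delta6 : delta <= 6^-1.
  rewrite -(@ler_pXn2r _ 2)// ?nnegrE ?invr_ge0// delta2.
  apply: (@le_trans _ _ ((2 + alpha) * (2 / Num.sqrt n%:R))).
    by rewrite ler_pM2l ?ln_over_id_le//; lra.
  by rewrite mulrA ler_pdivrMr// exprVn; lra.
split; first exact/andP.
have -> : n%:R * delta ^+ 2 = (2 + alpha) * ln n%:R.
  by rewrite delta2; field; rewrite gt_eqF.
rewrite /powR gt_eqF//.
have -> : - ((2 + alpha) * ln n%:R) + 2 * delta =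
    - alpha * ln n%:R + (- (2 * ln n%:R) + 2 * delta) by ring.
rewrite expRD expRD expRN expRM_natl lnK ?posrE//.
have e2 : expR (2 * delta) <= 2.
  by apply: le_trans (expR_le_quadratic _) _; nra.
have -> : n.+1%:R * (2 * (expR (- alpha * ln n%:R) *
      (n%:R ^- 2 * expR (2 * delta)))) =
    expR (- alpha * ln n%:R) * (n.+1%:R * 2 * expR (2 * delta) / n%:R ^+ 2).
  by move: (expR _) (expR _) (n%:R ^- 2) => u v w; ring.
rewrite -[leRHS]mulr1 ler_pM2l ?expR_gt0// ler_pdivrMr ?exprn_gt0// mul1r.
apply: (@le_trans _ _ (n.+1%:R * 2 * 2)); first by rewrite ler_wpM2l// mulr_ge0.
by rewrite -!natrM -natrX ler_nat; nia.
Qed.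

(** * The circle is disintegrable *)

Theorem theorem4p6 (R : realType) (c C alpha : R) :
  0 < c -> c <= C -> 0 < alpha ->
  exists n0 : nat,
    forall (mu : probability (borel (circle R)) R) (f : borel (circle R) -> R),
      has_density mu circle_uniform f ->
      (forall x, c <= f x <= C) ->
      forall n : nat, (0 < n)%N -> (n0 <= n)%N ->
        disintegrable mu n (n%:R `^ (- alpha))
          (2 * c^-1 * Num.sqrt ((2 + alpha) * (ln n%:R / n%:R))).
Proof.
move=> c0 cC a0; have [n0 rate] := rate_bounds a0.
exists n0 => mu f fmu fb n npos n0n d Psi P X iidX.
have := rate n n0n npos; cbv zeta; set delta := Num.sqrt _ => -[d6 small].
have nR : n%:R != 0 :> R by rewrite pnatr_eq0 -lt0n.
have arcB s t : 0 <= s -> s <= t -> t <= 2 * pi ->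
    c * ((t - s) / (2 * pi)) <= fine (mu (circle_arc s t))
      <= C * ((t - s) / (2 * pi)).
  move=> s0 st t2; rewrite -circle_uniform_arc//.
  apply: (density_bounds fmu (ltW c0) fb); exact: measurable_arc.
pose F t := fine (mu (circle_arc 0 t)).
have FB s t : 0 <= s -> s <= t -> t <= 2 * pi ->
    0 <= F t - F s <= C / (2 * pi) * (t - s).
  move=> s0 st t2.
  rewrite /F (measure_arc_cat mu s0 st) addrC addKr fine_ge0//=.
  by rewrite mulrAC -mulrA; case/andP: (arcB s t s0 st t2).
have F0 : F 0 = 0.
  rewrite /F (_ : circle_arc 0 0 = set0) ?measure0//.
  by apply/seteqP; split => // x; rewrite /circle_arc/=; lra.
(* Beyond n the quantile has no meaning: any angle in range will do. *)
have quantile k : exists s, 0 <= s <= 2 * pi /\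
    ((k <= n)%N -> F s = k%:R / n%:R).
  have [kn|_] := leqP k n; last first.
    by exists 0; split=> //; rewrite lexx ltW// twopi_gt0.
  have [|||s sI sE] := @lipschitz_ivt _ F 0 (2 * pi) (C / (2 * pi)) _ _ FB (k%:R / n%:R).
  - exact/ltW/twopi_gt0.
  - by rewrite divr_ge0 ?(ltW twopi_gt0)//; lra.
  - rewrite F0 /F measure_arc_full divr_ge0//= ler_pdivrMr ?ltr0n// mul1r.
    by rewrite ler_nat.
  - by exists s.
have [q /all_and2[qI qE]] := choice quantile.
have [E [mE PE good]] := @hits_uniform_deviation _ _ _ _ _ _ _ _ _ 'I_n.+1
  (fun k => circle_arc 0 (q k)) delta iidX (fun k => measurable_arc _ _) d6.
exists E; split=> //.
  by apply: le_trans PE; rewrite lee_fin lerB// card_ord.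
move=> w Ew; apply: (disintegration_of_counts c0 npos _ qI qE).
  by move=> s t s0 st t2; case/andP: (arcB s t s0 st t2).
move=> k kn; have := good w Ew (Ordinal (kn : (k < n.+1)%N)).
rewrite /= -/(F _) qE// (mulrC n%:R) divfK//.
Qed.
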